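(* Let $M$ be a quaternion locally compact manifold with an atlas $At(M)=\{(U_j,\phi_j):j\}$ such that the transition mappings $\phi_j\circ\phi_k^{-1}$ of charts with $U_j\cap U_k\ne\emptyset$ are either right or left superlinearly superdifferentiable. Then $M$ is orientable.
   Context: $\mathbf H$ denotes the quaternion skew field; $\tilde z=z^*$ is the conjugate of $z$. A map $f$ between open subsets of spaces $\mathbf H^n$ is quaternion holomorphic (superdifferentiable in $z$ with $\tilde\partial f=0$) if it is locally $z$-analytic: near each point it is given by a convergent power series whose terms are sums of noncommutative monomials $a_1z_{s_1}a_2z_{s_2}\cdots z_{s_p}a_{p+1}$ in the (centred) coordinates $z_s$ with quaternion coefficients. Its superdifferential $D_zf$ is its Fréchet derivative, in general only real-linear. $f$ is right (respectively left) superlinearly superdifferentiable if at each point the superdifferential is right (respectively left) superlinear, i.e. $D_zf.(h\lambda)=(D_zf.h)\lambda$ (respectively $D_zf.(\lambda h)=\lambda(D_zf.h)$) for all vectors $h$ and all $\lambda\in\mathbf H$. A quaternion manifold is a metric separable space with an at most countable atlas of charts that are homeomorphisms onto $C^\infty$-domains of $X=\mathbf H^n$ or $X=l_2(\mathbf H)$ (square-summable quaternion sequences), with quaternion biholomorphic transition maps. *)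

(* Defs.v *)
From HB Require Import structures.
From mathcomp Require Import all_boot all_order all_algebra.
From mathcomp Require Import all_classical all_reals all_analysis.
From mathcomp Require Import ring lra.

Set Implicit Arguments.
Unset Strict Implicit.
Unset Printing Implicit Defensive.

Import Order.TTheory GRing.Theory Num.Theory.
Import numFieldNormedType.Exports.

Local Open Scope classical_set_scope.
Local Open Scope ring_scope.

(* The quaternion skew field: Quat a b c d is a + b i + c j + d k. *)

Record quat (R : realType) := Quat { qre : R; qi : R; qj : R; qk : R }.

Section QuatRing.
Context (R : realType).
Implicit Types p q r : quat R.

Let to_prod q := (qre q, qi q, qj q, qk q).
Let of_prod (t : R * R * R * R) := Quat t.1.1.1 t.1.1.2 t.1.2 t.2.
Let to_prodK : cancel to_prod of_prod. Proof. by case. Qed.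

HB.instance Definition _ := Choice.copy (quat R) (can_type to_prodK).

Definition qadd p q :=
  Quat (qre p + qre q) (qi p + qi q) (qj p + qj q) (qk p + qk q).
Definition qopp p := Quat (- qre p) (- qi p) (- qj p) (- qk p).
Definition qmul p q := Quat
  (qre p * qre q - qi p * qi q - qj p * qj q - qk p * qk q)
  (qre p * qi q + qi p * qre q + qj p * qk q - qk p * qj q)
  (qre p * qj q - qi p * qk q + qj p * qre q + qk p * qi q)
  (qre p * qk q + qi p * qj q - qj p * qi q + qk p * qre q).
Definition qscale (a : R) q := Quat (a * qre q) (a * qi q) (a * qj q) (a * qk q).

Let qaddA : associative qadd.
Proof. by move=> p q r; congr Quat; rewrite /= addrA. Qed.
Let qaddC : commutative qadd.
Proof. by move=> p q; congr Quat; rewrite addrC. Qed.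
Let qadd0 : left_id (Quat 0 0 0 0) qadd.
Proof. by case=> *; congr Quat; rewrite add0r. Qed.
Let qaddN : left_inverse (Quat 0 0 0 0) qopp qadd.
Proof. by move=> q; congr Quat; rewrite addNr. Qed.

HB.instance Definition _ :=
  GRing.isZmodule.Build (quat R) qaddA qaddC qadd0 qaddN.

Let qmulA : associative qmul.
Proof. by move=> p q r; congr Quat => /=; ring. Qed.
Let qmul1 : left_id (Quat 1 0 0 0) qmul.
Proof. by case=> *; congr Quat => /=; ring. Qed.
Let qmulr1 : right_id (Quat 1 0 0 0) qmul.
Proof. by case=> *; congr Quat => /=; ring. Qed.
Let qmulDl : left_distributive qmul qadd.
Proof. by move=> p q r; congr Quat => /=; ring. Qed.
Let qmulDr : right_distributive qmul qadd.
Proof. by move=> p q r; congr Quat => /=; ring. Qed.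
Let qone_neq0 : Quat 1 0 0 0 != 0 :> quat R.
Proof. by apply/eqP => -[] /eqP; rewrite oner_eq0. Qed.

HB.instance Definition _ := GRing.Zmodule_isNzRing.Build (quat R)
  qmulA qmul1 qmulr1 qmulDl qmulDr qone_neq0.

Let qscaleA a b q : qscale a (qscale b q) = qscale (a * b) q.
Proof. by congr Quat; rewrite /= mulrA. Qed.
Let qscale1 : left_id 1 qscale.
Proof. by case=> *; congr Quat; rewrite /= mul1r. Qed.
Let qscaleDr : right_distributive qscale +%R.
Proof. by move=> a p q; congr Quat; rewrite /= mulrDr. Qed.
Let qscaleDl q : {morph qscale^~ q : a b / a + b}.
Proof. by move=> a b; congr Quat; rewrite /= mulrDl. Qed.

HB.instance Definition _ := GRing.Zmodule_isLmodule.Build R (quat R)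
  qscaleA qscale1 qscaleDr qscaleDl.

Definition qsqnorm q : R := qre q ^+ 2 + qi q ^+ 2 + qj q ^+ 2 + qk q ^+ 2.

Lemma qsqnorm_ge0 q : 0 <= qsqnorm q.
Proof. by rewrite /qsqnorm !addr_ge0 ?sqr_ge0. Qed.

Lemma qsqnorm0 : qsqnorm 0 = 0.
Proof. by rewrite /qsqnorm /= expr0n /= !addr0. Qed.

Lemma qsqnorm_eq0 q : qsqnorm q = 0 -> q = 0.
Proof.
move=> /eqP; rewrite /qsqnorm !paddr_eq0 ?addr_ge0 ?sqr_ge0// !sqrf_eq0.
by case: q => a b c d /= /andP[/andP[/andP[/eqP-> /eqP->] /eqP->] /eqP->].
Qed.

Lemma qsqnormM p q : qsqnorm (p * q) = qsqnorm p * qsqnorm q.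
Proof. by rewrite /qsqnorm /=; ring. Qed.

Lemma qsqnormZ a q : qsqnorm (a *: q) = a ^+ 2 * qsqnorm q.
Proof. by rewrite /qsqnorm /=; ring. Qed.

Let sqrD_wt (t x y : R) : 0 < t -> t < 1 ->
  (x + y) ^+ 2 <= x ^+ 2 / t + y ^+ 2 / (1 - t).
Proof.
move=> t0 t1; have s0 : 0 < 1 - t by rewrite subr_gt0.
rewrite -subr_ge0.
have -> : x ^+ 2 / t + y ^+ 2 / (1 - t) - (x + y) ^+ 2 =
    ((1 - t) * x - t * y) ^+ 2 / (t * (1 - t)).
  by field; rewrite !gt_eqF.
by rewrite divr_ge0 ?sqr_ge0// mulr_ge0// ltW.
Qed.

Lemma qsqnormD_wt (t : R) p q : 0 < t -> t < 1 ->
  qsqnorm (p + q) <= t^-1 * qsqnorm p + (1 - t)^-1 * qsqnorm q.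
Proof.
move=> t0 t1; rewrite /qsqnorm /=.
have := sqrD_wt (qre p) (qre q) t0 t1.
have := sqrD_wt (qi p) (qi q) t0 t1.
have := sqrD_wt (qj p) (qj q) t0 t1.
have := sqrD_wt (qk p) (qk q) t0 t1.
lra.
Qed.

End QuatRing.

(* l2 R I is the space of square-summable families of quaternions indexed by I,
   normed by the square root of the sum of the |z s|^2.  It is H^n for I = 'I_n,
   where summability holds automatically, and l_2(H) for I = nat. *)

Section L2.
Context (R : realType) (I : countType).

Definition sqsummable : set (I -> quat R) :=
  [set z | summable setT (fun s => (qsqnorm (z s))%:E)].

Definition l2_pred : {pred I -> quat R} := mem sqsummable.

Record l2 := L2 { l2_val :> I -> quat R; l2_valP : l2_val \in l2_pred }.

HB.instance Definition _ := [isSub for l2_val].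
HB.instance Definition _ := [Choice of l2 by <:].

Let sq (z : I -> quat R) : \bar R := \esum_(s in setT) (qsqnorm (z s))%:E.

Let sq_ge0 z : (0 <= sq z)%E.
Proof. by apply: esum_ge0 => s _; rewrite lee_fin qsqnorm_ge0. Qed.

Let sqP z : (z \in l2_pred) = (sq z < +oo)%E.
Proof.
have e : (\esum_(s in setT) `|(qsqnorm (z s))%:E| = sq z)%E.
  by apply: eq_esum => s _; rewrite gee0_abs// lee_fin qsqnorm_ge0.
by apply/idP/idP => [/set_mem|h]; last apply/mem_set;
  rewrite /sqsummable /summable /= e.
Qed.

Let esum_scale_le (c : R) (z : I -> quat R) : 0 <= c ->
  (\esum_(s in setT) (c * qsqnorm (z s))%:E <= c%:E * sq z)%E.
Proof.
move=> c0; apply: ge_ereal_sup => _ [X [finX _]] <-.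
rewrite [X in (X <= _)%E](_ : _ =
    c%:E * \sum_(s \in X) (qsqnorm (z s))%:E)%E; last first.
  rewrite ge0_mule_fsumr// => s; by rewrite lee_fin qsqnorm_ge0.
apply: lee_wpmul2l; first by rewrite lee_fin.
by apply: ereal_sup_ubound; exists X.
Qed.

Let sqD (t : R) (x y : I -> quat R) : 0 < t -> t < 1 ->
  (sq (x + y)%R <= t^-1%:E * sq x + (1 - t)^-1%:E * sq y)%E.
Proof.
move=> t0 t1; have s0 : 0 < 1 - t by rewrite subr_gt0.
have t0' : 0 <= t^-1 by rewrite invr_ge0 ltW.
have s0' : 0 <= (1 - t)^-1 by rewrite invr_ge0 ltW.
apply: (@le_trans _ _ (\esum_(s in setT)
    ((t^-1 * qsqnorm (x s))%:E + ((1 - t)^-1 * qsqnorm (y s))%:E))%E).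
  by apply: le_esum => s _; rewrite -EFinD lee_fin qsqnormD_wt.
rewrite esumD; last 2 first.
- by move=> s _; rewrite lee_fin mulr_ge0 ?qsqnorm_ge0.
- by move=> s _; rewrite lee_fin mulr_ge0 ?qsqnorm_ge0.
by apply: leeD; exact: esum_scale_le.
Qed.

Let sqZ (a : R) (z : I -> quat R) : (sq (a *: z)%R <= (a ^+ 2)%:E * sq z)%E.
Proof.
rewrite {1}/sq; under eq_esum => ? _ do rewrite qsqnormZ.
exact: esum_scale_le (sqr_ge0 _).
Qed.

Let l2_submod_closed : submod_closed l2_pred.
Proof.
split=> [|a x y].
  rewrite sqP /sq esum1 ?ltry// => s _; by rewrite qsqnorm0.
rewrite !sqP => hx hy.
have h0 : 0 < (1 / 2 : R) by lra.
have h1 : (1 / 2 : R) < 1 by lra.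
apply: (le_lt_trans (sqD _ _ h0 h1)); apply: lte_add_pinfty.
- apply: lte_mul_pinfty; rewrite ?lee_fin ?invr_ge0 ?(ltW h0)//.
  apply: (le_lt_trans (sqZ _ _)); apply: lte_mul_pinfty => //.
  by rewrite lee_fin sqr_ge0.
- by apply: lte_mul_pinfty; rewrite ?lee_fin ?invr_ge0 ?subr_ge0 ?(ltW h1)//.
Qed.

HB.instance Definition _ :=
  GRing.isSubmodClosed.Build _ _ l2_pred l2_submod_closed.
HB.instance Definition _ := [SubChoice_isSubLmodule of l2 by <:].

Definition l2norm (z : l2) : R :=
  Num.sqrt (fine (\esum_(s in setT) (qsqnorm (z s))%:E)).

Let nsq (z : l2) : R := fine (sq z).

Let nsq_ge0 z : 0 <= nsq z. Proof. by rewrite fine_ge0. Qed.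

Let nsqE (z : l2) : (nsq z)%:E = sq z.
Proof.
rewrite /nsq fineK// ge0_fin_numE//; by rewrite -sqP l2_valP.
Qed.

Let l2norm_sqr z : l2norm z ^+ 2 = nsq z.
Proof. by rewrite /l2norm sqr_sqrtr// nsq_ge0. Qed.

Let l2norm_eq0 z : l2norm z = 0 -> z = 0.
Proof.
move=> h; have: nsq z = 0 by rewrite -l2norm_sqr h expr0n.
move=> h0; apply/val_inj/funext => s; apply/qsqnorm_eq0/eqP.
rewrite eq_le qsqnorm_ge0 andbT -lee_fin -[X in (_ <= X%:E)%E]h0 nsqE.
rewrite -(@esum_set1 R I s (fun s => (qsqnorm (z s))%:E)) ?lee_fin ?qsqnorm_ge0//.
rewrite /sq (esumID [set s] setT) ?setTI; last first.
  by move=> i _; rewrite lee_fin qsqnorm_ge0.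
by rewrite leeDl// esum_ge0// => i _; rewrite lee_fin qsqnorm_ge0.
Qed.

Let l2normD x y : l2norm (x + y) <= l2norm x + l2norm y.
Proof.
have nx : 0 <= l2norm x by exact: sqrtr_ge0.
have ny : 0 <= l2norm y by exact: sqrtr_ge0.
have [->|x0] := eqVneq x 0; first by rewrite add0r lerDr sqrtr_ge0.
have [->|y0] := eqVneq y 0; first by rewrite addr0 lerDl sqrtr_ge0.
have px : 0 < l2norm x.
  by rewrite lt_def nx andbT; apply: contra_neq x0 => /l2norm_eq0.
have py : 0 < l2norm y.
  by rewrite lt_def ny andbT; apply: contra_neq y0 => /l2norm_eq0.
have pxy : 0 < l2norm x + l2norm y by exact: addr_gt0.
rewrite -(@ler_pXn2r _ 2)// ?nnegrE ?sqrtr_ge0// ?addr_ge0// l2norm_sqr.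
set t := l2norm x / (l2norm x + l2norm y).
have t0 : 0 < t by exact: divr_gt0.
have t1 : t < 1 by rewrite /t ltr_pdivrMr// mul1r ltrDl.
have := @sqD t x y t0 t1.
rewrite -[l2_val x + l2_val y]/(l2_val (x + y)) -!nsqE -!EFinM -EFinD lee_fin.
move=> /le_trans; apply; rewrite -!l2norm_sqr /t le_eqVlt; apply/orP; left.
apply/eqP; field.
rewrite !gt_eqF//=.
by rewrite [X in 0 < X](_ : _ = l2norm y)//; ring.
Qed.

Let l2normZ_le (a : R) (z : l2) : l2norm (a *: z) <= `|a| * l2norm z.
Proof.
rewrite -(@ler_pXn2r _ 2)// ?nnegrE ?sqrtr_ge0 ?mulr_ge0 ?sqrtr_ge0//.
rewrite exprMn !l2norm_sqr real_normK ?num_real// -lee_fin EFinM !nsqE.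
exact: sqZ.
Qed.

Let l2normZ (a : R) (z : l2) : l2norm (a *: z) = `|a| * l2norm z.
Proof.
apply/eqP; rewrite eq_le l2normZ_le /=.
have [->|a0] := eqVneq a 0; first by rewrite normr0 mul0r sqrtr_ge0.
have := l2normZ_le a^-1 (a *: z).
rewrite scalerA mulVf// scale1r normfV => h.
by rewrite mulrC -ler_pdivlMr ?normr_gt0// mulrC.
Qed.

HB.instance Definition _ :=
  Lmodule_isNormed.Build R l2 l2normD l2normZ l2norm_eq0.

Let lmul_subproof (a : quat R) (z : l2) : (fun s => a * z s) \in l2_pred.
Proof.
rewrite sqP /sq; under eq_esum => ? _ do rewrite qsqnormM.
apply: (le_lt_trans (esum_scale_le _ (qsqnorm_ge0 _))).
by rewrite -nsqE -EFinM ltry.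
Qed.

Let rmul_subproof (z : l2) (a : quat R) : (fun s => z s * a) \in l2_pred.
Proof.
rewrite sqP /sq; under eq_esum => ? _ do rewrite qsqnormM mulrC.
apply: (le_lt_trans (esum_scale_le _ (qsqnorm_ge0 _))).
by rewrite -nsqE -EFinM ltry.
Qed.

Let single_subproof (t : I) (a : quat R) :
  (fun s => if s == t then a else 0) \in l2_pred.
Proof.
rewrite sqP /sq (esumID [set t] setT) ?setTI; last first.
  by move=> i _; rewrite lee_fin qsqnorm_ge0.
rewrite esum_set1 ?lee_fin ?qsqnorm_ge0//= eqxx esum1 ?adde0 ?ltry// => i /= it.
by rewrite ifF ?qsqnorm0//; apply/eqP.
Qed.

Definition lmul (a : quat R) (z : l2) : l2 := L2 (lmul_subproof a z).
Definition rmul (z : l2) (a : quat R) : l2 := L2 (rmul_subproof z a).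
Definition single (t : I) (a : quat R) : l2 := L2 (single_subproof t a).

End L2.

Section Holomorphic.
Context (R : realType) (I : countType).
Local Notation X := (l2 R I).

(* The monomial a_1 z_{s_1} a_2 z_{s_2} ... z_{s_p} a_{p+1}, contributing to the
   coordinate mon_coord of the value; here mon_head is a_1 and mon_tail is
   (s_1, a_2), ..., (s_p, a_{p+1}). *)
Record monomial := Monomial {
  mon_coord : I;
  mon_head : quat R;
  mon_tail : seq (I * quat R) }.

Definition mon_degree (m : monomial) : nat := size (mon_tail m).

Definition mon_eval (m : monomial) (z : X) : X :=
  single (mon_coord m)
    (mon_head m * \prod_(sa <- mon_tail m) (z sa.1 * sa.2)).

(* P k is the homogeneous term of degree k.  It is a convergent series of finite
   sums of monomials: one finite sum is enough when X = H^n, while in l_2(H)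
   already z |-> z needs one monomial for each coordinate. *)
Definition z_analytic_at (f : X -> X) (c : X) : Prop :=
  exists (mon : nat -> nat -> seq monomial) (P : nat -> X -> X),
    (forall k i, all (fun a => mon_degree a == k) (mon k i)) /\
    \forall z \near c,
      (forall k, series (fun i => \sum_(a <- mon k i) mon_eval a (z - c)) @ \oo
                   --> P k (z - c)) /\
      series (fun k => P k (z - c)) @ \oo --> f z.

Definition quaternion_holomorphic (D : set X) (f : X -> X) : Prop :=
  forall c, D c -> z_analytic_at f c.

Definition quaternion_biholomorphic (D E : set X) (f g : X -> X) : Prop :=
  [/\ f @` D = E, {in D, cancel f g},
      quaternion_holomorphic D f & quaternion_holomorphic E g].

Definition right_superlinearly_superdifferentiable (D : set X) (f : X -> X) :=
  forall z, D z -> differentiable f z /\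
    forall h a, 'd f z (rmul h a) = rmul ('d f z h) a.

Definition left_superlinearly_superdifferentiable (D : set X) (f : X -> X) :=
  forall z, D z -> differentiable f z /\
    forall h a, 'd f z (lmul a h) = lmul a ('d f z h).

End Holomorphic.

(* C^k on V, through the iterated tangent maps (x, v) |-> 'd f x v. *)
Fixpoint Ck (R : realType) (k : nat) (Y : normedModType R) (f : Y -> R^o)
    (V : set Y) : Prop :=
  match k with
  | 0 => forall x, V x -> {for x, continuous f}
  | k'.+1 => (forall x, V x -> differentiable f x) /\
      @Ck R k' (Y * Y)%type (fun p => 'd f (p.1) (p.2)) (V `*` setT)
  end.

(* The boundary of D is smooth: near each of its points D is the sublevel set
   rho < 0 of a C^oo function rho with nonzero differential at the point. *)
Definition smooth_domain (R : realType) (Y : normedModType R) (D : set Y) :=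
  open D /\
  forall p, closure D p -> ~ D p ->
    exists (V : set Y) (rho : Y -> R^o),
      [/\ open V, V p, (forall k, Ck k rho V), (exists v, 'd rho p v != 0) &
          D `&` V = [set x | V x /\ rho x < 0]].

(* The model space of m : model is l2 R (model_index m). *)
Inductive model := Hn of nat | L2H.

Definition model_index (m : model) : countType :=
  match m with Hn n => 'I_n | L2H => nat end.

Section Manifold.
Context (R : realType) (m : model) (M : metricType R).
Local Notation X := (l2 R (model_index m)).

(* chart_inv is the inverse of chart_map on its image; the values of the two
   maps outside chart_dom and its image are irrelevant. *)
Record chart := Chart {
  chart_dom : set M;
  chart_map : M -> X;
  chart_inv : X -> M;
  chart_dom_open : open chart_dom;
  chart_mapK : {in chart_dom, cancel chart_map chart_inv};
  chart_map_continuous : {within chart_dom, continuous chart_map};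
  chart_inv_continuous :
    {within chart_map @` chart_dom, continuous chart_inv};
  chart_image_domain : smooth_domain (chart_map @` chart_dom) }.

Definition transition (c d : chart) : X -> X := chart_map c \o chart_inv d.

Definition transition_dom (c d : chart) : set X :=
  chart_map d @` (chart_dom c `&` chart_dom d).

Record quaternion_manifold := QuaternionManifold {
  manifold_separable : exists S : set M, countable S /\ dense S;
  atlas_index : countType;
  atlas : atlas_index -> chart;
  atlas_cover : \bigcup_j chart_dom (atlas j) = setT;
  atlas_biholomorphic : forall j k,
    chart_dom (atlas j) `&` chart_dom (atlas k) !=set0 ->
    quaternion_biholomorphic
      (transition_dom (atlas j) (atlas k)) (transition_dom (atlas k) (atlas j))
      (transition (atlas j) (atlas k)) (transition (atlas k) (atlas j)) }.

End Manifold.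

(* delta is the determinant of the real-linear map L, computed in some finite
   real basis of Y; in particular Y is finite-dimensional over R. *)
Definition real_det (R : realType) (Y : normedModType R) (L : Y -> Y)
    (delta : R) : Prop :=
  exists (d : nat) (e : 'I_d -> Y) (A : 'M[R]_d),
    [/\ forall x, exists! u : 'rV[R]_d, x = \sum_i u 0 i *: e i,
        forall i, L (e i) = \sum_j A i j *: e j &
        delta = \det A].

(* An orientation of M is a continuous choice of orientations of the real
   tangent spaces T_p M.  It is encoded by signs: o j p tells whether the chosen
   orientation of T_p M is the one carried over by the j-th chart from a fixed
   orientation of the model space.  The choice is continuous when o j is locally
   constant on the domain of the chart, and two charts at p induce the same
   orientation of T_p M exactly when the Jacobian of their transition mapping
   is positive. *)
Definition orientable (R : realType) (m : model) (M : metricType R)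
    (Q : quaternion_manifold m M) : Prop :=
  exists o : atlas_index Q -> M -> bool,
    (forall j p, chart_dom (atlas j) p -> \forall q \near p, o j q = o j p) /\
    (forall j k p, chart_dom (atlas j) p -> chart_dom (atlas k) p ->
       exists delta : R,
         [/\ real_det
               ('d (transition (atlas j) (atlas k)) (chart_map (atlas k) p))
               delta,
             delta != 0 &
             (o j p == o k p) = (0 < delta)]).

(* Main.v *)
Require Import Defs.
From HB Require Import structures.
From mathcomp Require Import all_boot all_order all_algebra.
From mathcomp Require Import all_classical all_reals all_analysis.
From mathcomp Require Import complex ring.

(** The orientation that every chart carries over from the model space is the
    same for all charts, because the Jacobian of a transition mapping is
    positive: the constant choice of signs orients M.

    A superlinear differential L commutes with the multiplication J by the
    quaternion unit i, on the right or on the left according to the side on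
    which L is superlinear.  Since J^2 = -1, this makes L complex linear for the
    complex structure J.  In a
    real basis v_1, ..., v_k, J v_1, ..., J v_k the matrix of L is made of the
    blocks P, Q, -Q, P, and its determinant is |det (P + iQ)|^2 >= 0
    ([det_block_complex_ge0], [real_det_commuting_gt0]).  Superlinearity holds
    for the transition mappings in both directions, possibly on different sides,
    so both are differentiable; they are inverse to each other near the point,
    hence L is injective by the chain rule and the determinant is nonzero.

    Over H^n the vectors v are the e_s and the e_s j
    ([half_basis_real_basis]).  Over l_2(H), local compactness forces M to be
    empty: a chart would carry a compact neighbourhood of a point to a compact
    neighbourhood in l_2(H), but the points a + t e_n are pairwise at distance at least t
    ([l2_nat_compact_not_nbhs]). *)

Set Implicit Arguments.
Unset Strict Implicit.
Unset Printing Implicit Defensive.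

Import Order.TTheory GRing.Theory Num.Theory.
Import numFieldNormedType.Exports.

Local Open Scope classical_set_scope.
Local Open Scope ring_scope.

(** * Determinants of complex linear maps *)

(** Over the complex numbers, conjugation by a unipotent block matrix makes the
    matrix block triangular with diagonal blocks P - iQ and P + iQ, whose
    determinants are conjugate to each other. *)
Lemma det_block_complex_ge0 (R : rcfType) (k : nat) (P Q : 'M[R]_k) :
  0 <= \det (block_mx P Q (- Q) P).
Proof.
pose toC := map_mx (real_complex R).
pose iM : 'M[R[i]]_k := ('i%C)%:M.
pose Z : 'M[R[i]]_k := toC _ _ P + iM *m toC _ _ Q.
pose W : 'M[R[i]]_k := toC _ _ P - iM *m toC _ _ Q.
have detW : \det W = (\det Z)^*%C.
  rewrite -det_map_mx; congr (\det _); apply/matrixP => a b.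
  by rewrite /W /Z /iM !mul_scalar_mx !mxE; simpc.
have e : block_mx 1%:M iM 0 1%:M *m toC _ _ (block_mx P Q (- Q) P)
    *m block_mx 1%:M (- iM) 0 1%:M = block_mx W 0 (- toC _ _ Q) Z.
  rewrite /toC map_block_mx !mulmx_block !(mul1mx, mul0mx, mulmx0, mulmx1, addr0, add0r).
  rewrite /W /Z /iM !(mul_scalar_mx, mul_mx_scalar, scalerDr, scalerN, scaleNr).
  have ii (A : 'M[R[i]]_k) : 'i%C *: ('i%C *: A) = - A.
    by rewrite scalerA -expr2 sqr_i scaleN1r.
  rewrite map_mxN /= !mulmxN !(mul_scalar_mx, mul_mx_scalar, scalerDr, scalerN).
  rewrite ii opprK; congr block_mx.
    by rewrite [X in _ + X]addrC addNr.
  by rewrite opprK addrC.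
have := congr1 determinant e.
rewrite !det_mulmx !det_ublock det_lblock !det1 !(mul1r, mulr1) detW mulrC.
rewrite det_map_mx -ler0c => ->; exact: mulcJ_ge0.
Qed.

(** J is a complex structure, L is complex linear for it and v is a complex
    basis: in the real basis v, J v the matrix of L has the block form of
    [det_block_complex_ge0]. *)
Lemma real_det_commuting_gt0 (R : realType) (Y : normedModType R)
    (J : Y -> Y) (L : {linear Y -> Y}) (k : nat) (v : 'I_k -> Y) :
  linear J -> (forall x, J (J x) = - x) -> (forall x, L (J x) = J (L x)) -> injective L ->
  (forall x, exists! u : 'rV[R]_(k + k),
     x = \sum_a u 0 (lshift k a) *: v a + \sum_a u 0 (rshift k a) *: J (v a)) ->
  exists2 delta, real_det L delta & 0 < delta.
Proof.
move=> linJ JJ LJ injL basis.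
pose Jl : {linear Y -> Y} := HB.pack J (GRing.isLinear.Build R Y Y *:%R J linJ).
pose e (i : 'I_(k + k)) := match fintype.split i with inl a => v a | inr a => J (v a) end.
have el a : e (lshift k a) = v a by rewrite /e (unsplitK (inl a)).
have er a : e (rshift k a) = J (v a) by rewrite /e (unsplitK (inr a)).
have eE (w : 'I_(k + k) -> R) : \sum_i w i *: e i =
    \sum_a w (lshift k a) *: v a + \sum_a w (rshift k a) *: J (v a).
  by rewrite big_split_ord /=; congr (_ + _); apply: eq_bigr => a _;
    rewrite ?el ?er.
have ebasis x : exists! u : 'rV[R]_(k + k), x = \sum_i u 0 i *: e i.
  have [u [xu uniq_u]] := basis x; exists u; split; first by rewrite eE.
  by move=> u'; rewrite eE; exact: uniq_u.
have [c cP] : exists c : 'I_k -> 'rV[R]_(k + k),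
    forall a, L (v a) = \sum_i c a 0 i *: e i.
  have [c cP] := choice (fun a : 'I_k => ebasis (L (v a))).
  by exists c => a; have [] := cP a.
pose P := \matrix_(a, b) c a 0 (lshift k b).
pose Q := \matrix_(a, b) c a 0 (rshift k b).
pose A := block_mx P Q (- Q) P.
have LA i : L (e i) = \sum_j A i j *: e j.
  rewrite eE -(splitK i); case: (fintype.split i) => a /=; rewrite ?el ?er.
    rewrite cP eE; congr (_ + _); apply: eq_bigr => b _.
      by rewrite block_mxEul mxE.
    by rewrite block_mxEur mxE.
  rewrite LJ cP eE -[J _]/(Jl _) linearD !linear_sum addrC; congr (_ + _).
    by apply: eq_bigr => b _; rewrite linearZ /= JJ block_mxEdl !mxE scalerN scaleNr.
  by apply: eq_bigr => b _; rewrite linearZ /= block_mxEdr !mxE.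
exists (\det A); first by exists (k + k)%N, e, A.
(* If det A were zero, a nonzero row vector u with u A = 0 would give a nonzero
   vector in the kernel of L. *)
rewrite lt_def det_block_complex_ge0 andbT; apply/negP => /det0P[u /negP u0 uA].
apply/u0/eqP.
have Lu0 : L (\sum_i u 0 i *: e i) = 0.
  rewrite linear_sum /=.
  under eq_bigr => i _ do rewrite linearZ /= LA scaler_sumr.
  rewrite exchange_big /= big1 // => j _.
  under eq_bigr => i _ do rewrite scalerA.
  rewrite -scaler_suml -[X in X *: _](_ : (u *m A) 0 j = _); last by rewrite mxE.
  by rewrite uA mxE scale0r.
have [w [_ uniq_w]] := ebasis 0.
transitivity w; last first.
  by apply: uniq_w; rewrite big1 // => i _; rewrite mxE scale0r.
by apply/esym/uniq_w/injL; rewrite Lu0 linear0.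
Qed.

(** * Differentials of inverse maps *)

Lemma diff_left_inverse (R : realType) (V W : normedModType R)
    (f : V -> W) (g : W -> V) (x : V) :
  differentiable f x -> differentiable g (f x) ->
  (\forall y \near x, (g \o f) y = y) -> cancel ('d f x) ('d g (f x)).
Proof.
move=> df dg gf h.
have dgf : differentiable (g \o f) x by exact: differentiable_comp.
transitivity ('d (g \o f) x h); first by rewrite (diff_comp df dg).
rewrite -deriveE // (near_eq_derive _ (g := id)) // deriveE //.
by have [_ ->] := is_diff_id x.
Qed.

(** * Coordinates and norm of l2 *)

Section l2_facts.
Context (R : realType) (I : countType).
Local Notation X := (l2 R I).

Lemma l2_eq (x y : X) : (forall s, x s = y s) -> x = y.
Proof. by move=> xy; apply/val_inj/funext. Qed.

Lemma rmul_is_linear (a : quat R) : linear (fun z : X => rmul z a).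
Proof.
move=> t x y; apply: l2_eq => s /=; rewrite mulrDl; congr (_ + _).
by congr Quat => /=; ring.
Qed.

Lemma lmul_is_linear (a : quat R) : linear (fun z : X => lmul a z).
Proof.
move=> t x y; apply: l2_eq => s /=; rewrite mulrDr; congr (_ + _).
by congr Quat => /=; ring.
Qed.

Lemma l2_normE (z : X) :
  `|z| = Num.sqrt (fine (\esum_(s in setT) (qsqnorm (z s))%:E)%E).
Proof. by []. Qed.

Lemma coord_le_norm (z : X) (s : I) : Num.sqrt (qsqnorm (z s)) <= `|z|.
Proof.
rewrite l2_normE; apply: ler_wsqrtr.
have fin : (\esum_(s in setT) (qsqnorm (z s))%:E)%E \is a fin_num.
  rewrite ge0_fin_numE ?esum_ge0 // => [|i _]; last by rewrite lee_fin qsqnorm_ge0.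
  have /set_mem := l2_valP z; rewrite /sqsummable /= /summable.
  by under eq_esum do rewrite gee0_abs ?lee_fin ?qsqnorm_ge0//.
rewrite -lee_fin fineK //.
rewrite -(@esum_set1 R I s (fun s => (qsqnorm (z s))%:E)) ?lee_fin ?qsqnorm_ge0//.
rewrite (esumID [set s] setT) ?setTI; last first.
  by move=> i _; rewrite lee_fin qsqnorm_ge0.
by rewrite leeDl// esum_ge0// => i _; rewrite lee_fin qsqnorm_ge0.
Qed.

Lemma norm_single (s : I) (a : quat R) :
  `|single s a : X| = Num.sqrt (qsqnorm a).
Proof.
rewrite l2_normE (esumID [set s] setT) ?setTI; last first.
  by move=> i _; rewrite lee_fin qsqnorm_ge0.
rewrite esum_set1 ?lee_fin ?qsqnorm_ge0//= eqxx esum1 ?adde0 //= => i is_.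
by rewrite ifF ?qsqnorm0//; apply/eqP.
Qed.

End l2_facts.

Lemma l2_val_sum (R : realType) (I : countType) (T : Type) (r : seq T)
    (F : T -> l2 R I) s :
  (\sum_(i <- r) F i) s = \sum_(i <- r) F i s.
Proof. by elim/big_rec2: _ => // i a b _ <-. Qed.

Lemma single_lin_comb (R : realType) (n : nat) (t : 'I_n -> R) (a : quat R)
    (s : 'I_n) :
  (\sum_i t i *: (single i a : l2 R 'I_n)) s = t s *: a.
Proof.
have E i : (t i *: (single i a : l2 R 'I_n)) s = t i *: (if s == i then a else 0).
  by [].
rewrite l2_val_sum; under eq_bigr => i _ do rewrite E.
rewrite (bigD1 s) //= eqxx big1 ?addr0 // => i /negPf si.
by rewrite eq_sym si scaler0.
Qed.

(** The vectors e_s and e_s j: with their products by i, on either side, they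
    form a real basis of H^n. *)
Definition half_basis (R : realType) (n : nat) (a : 'I_(n + n)) : l2 R 'I_n :=
  match fintype.split a with
  | inl s => single s 1
  | inr s => single s (Quat 0 0 1 0)
  end.

(** The sign eps accounts for the side of the multiplication J by i, as
    ij = k while ji = -k. *)
Lemma half_basis_real_basis (R : realType) (n : nat) (eps : R)
    (J : l2 R 'I_n -> l2 R 'I_n) : eps ^+ 2 = 1 ->
  (forall s, J (single s 1) = single s (Quat 0 1 0 0)) ->
  (forall s, J (single s (Quat 0 0 1 0)) = single s (Quat 0 0 0 eps)) ->
  forall x, exists! u : 'rV[R]_((n + n) + (n + n)),
    x = \sum_a u 0 (lshift (n + n) a) *: half_basis R a
      + \sum_a u 0 (rshift (n + n) a) *: J (half_basis R a).
Proof.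
move=> eps2 J1 Jj x.
have combE (u : 'rV[R]_((n + n) + (n + n))) s :
    (\sum_a u 0 (lshift (n + n) a) *: half_basis R a
      + \sum_a u 0 (rshift (n + n) a) *: J (half_basis R a)) s =
    Quat (u 0 (lshift _ (lshift n s))) (u 0 (rshift _ (lshift n s)))
         (u 0 (lshift _ (rshift n s))) (u 0 (rshift _ (rshift n s)) * eps).
  have hl i : half_basis R (lshift n i) = single i 1.
    by rewrite /half_basis (unsplitK (inl i)).
  have hr i : half_basis R (rshift n i) = single i (Quat 0 0 1 0).
    by rewrite /half_basis (unsplitK (inr i)).
  rewrite [X in l2_val X](_ : _ =
      (\sum_i u 0 (lshift _ (lshift n i)) *: single i 1
       + \sum_i u 0 (lshift _ (rshift n i)) *: single i (Quat 0 0 1 0))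
    + (\sum_i u 0 (rshift _ (lshift n i)) *: single i (Quat 0 1 0 0)
       + \sum_i u 0 (rshift _ (rshift n i)) *: single i (Quat 0 0 0 eps)));
    last first.
    by rewrite !big_split_ord /=; congr (_ + _ + (_ + _));
      apply: eq_bigr => i _; rewrite ?hl ?hr ?J1 ?Jj.
  set S1 := \sum_i _; set S2 := \sum_i _; set S3 := \sum_i _; set S4 := \sum_i _.
  rewrite -[LHS]/(S1 s + S2 s + (S3 s + S4 s)) !single_lin_comb.
  by congr Quat => /=; ring.
(* The coordinate along e_s (eps k) is eps times the one along e_s k, because
   eps is its own inverse. *)
pose row4 (a b c d : 'I_n -> R) : 'rV[R]_((n + n) + (n + n)) :=
  row_mx (row_mx (\row_s a s) (\row_s b s)) (row_mx (\row_s c s) (\row_s d s)).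
exists (row4 (fun s => qre (x s)) (fun s => qj (x s)) (fun s => qi (x s))
  (fun s => qk (x s) * eps)); split.
  apply: l2_eq => s; rewrite combE !(row_mxEl, row_mxEr) !mxE -mulrA -expr2 eps2 mulr1.
  by case: (x s).
move=> u xE; apply/rowP => i.
have xs s := combE u s; rewrite -xE in xs.
rewrite -(splitK i); case: (fintype.split i) => j;
  rewrite -(splitK j); case: (fintype.split j) => s /=;
  rewrite !(row_mxEl, row_mxEr) mxE xs //=.
by rewrite -mulrA -expr2 eps2 mulr1.
Qed.

Lemma single_rmul (R : realType) (I : countType) (s : I) (a b : quat R) :
  rmul (single s a) b = single s (a * b).
Proof. by apply: l2_eq => t /=; case: eqP => // _; rewrite mul0r. Qed.

Lemma single_lmul (R : realType) (I : countType) (s : I) (a b : quat R) :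
  lmul b (single s a) = single s (b * a).
Proof. by apply: l2_eq => t /=; case: eqP => // _; rewrite mulr0. Qed.

(** * Superlinear maps of H^n *)

(** A left superlinear map need not commute with right multiplications, so the
    complex structure is taken on the side where L is superlinear. *)
Lemma superlinear_real_det_gt0 (R : realType) (n : nat)
    (L : {linear l2 R 'I_n -> l2 R 'I_n}) : injective L ->
  (forall h a, L (rmul h a) = rmul (L h) a) \/
  (forall h a, L (lmul a h) = lmul a (L h)) ->
  exists2 delta, real_det L delta & 0 < delta.
Proof.
move=> injL; pose i : quat R := Quat 0 1 0 0.
have ii : i * i = -1 by congr Quat => /=; ring.
case=> comm.
- apply: (real_det_commuting_gt0 (J := fun z => rmul z i) (v := @half_basis R n)).
  + exact: rmul_is_linear.
  + by move=> x; apply: l2_eq => s /=; rewrite -mulrA ii mulrN1.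
  + by move=> x; exact: comm.
  + exact: injL.
  + apply: (half_basis_real_basis (eps := -1) (J := fun z => rmul z i));
      first by rewrite sqrrN expr1n.
      by move=> s; rewrite single_rmul mul1r.
    by move=> s; rewrite single_rmul; congr single; congr Quat => /=; ring.
- apply: (real_det_commuting_gt0 (J := fun z => lmul i z) (v := @half_basis R n)).
  + exact: lmul_is_linear.
  + by move=> x; apply: l2_eq => s /=; rewrite mulrA ii mulN1r.
  + by move=> x; exact: comm.
  + exact: injL.
  + apply: (half_basis_real_basis (eps := 1) (J := fun z => lmul i z)); first by rewrite expr1n.
      by move=> s; rewrite single_lmul mulr1.
    by move=> s; rewrite single_lmul; congr single; congr Quat => /=; ring.
Qed.

(** * Failure of local compactness in the sequence space *)

(** The n-th coordinate alone keeps a + (r/2) e_n at distance at least r/2 from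
    the later points of this sequence, which therefore has no cluster point. *)
Lemma l2_nat_compact_not_nbhs (R : realType) (a : l2 R nat) (K : set (l2 R nat)) :
  compact K -> ~ nbhs a K.
Proof.
move=> cK /nbhs_ballP[r /= r0 rK].
pose x (n : nat) : l2 R nat := a + single n (Quat (r / 2) 0 0 0).
have r2 : 0 < r / 2 by rewrite divr_gt0.
have norm_r2 : Num.sqrt (qsqnorm (Quat (r / 2) 0 0 0)) = r / 2.
  by rewrite /qsqnorm /= expr0n /= !addr0 sqrtr_sqr gtr0_norm.
have Kx n : K (x n).
  apply: rK; rewrite -ball_normE /= /x opprD addNKr normrN norm_single norm_r2.
  by rewrite gtr_pMr // invf_lt1 // ltr1n.
have far n m : (n < m)%N -> r / 2 <= `|x n - x m|.
  move=> nm; apply: le_trans (coord_le_norm _ n).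
  rewrite -[X in qsqnorm X]/((a n + _) - (a n + _)) /= eqxx ltn_eqF //.
  by rewrite addr0 addrAC subrr add0r norm_r2.
have FK : (x @ \oo) K by exists 0%N => // n _; exact: Kx.
have [p [_ clp]] := cK (x @ \oo) _ FK.
have r4 : 0 < r / 4 by rewrite divr_gt0.
have close N : exists2 n, (N <= n)%N & `|p - x n| < r / 4.
  have tail : (x @ \oo) [set x n | n in [set n | (N <= n)%N]].
    by exists N => // n Nn; exists n.
  have [_ [[n /= Nn <-]]] := clp _ _ tail (nbhsx_ballx p _ r4).
  by rewrite -ball_normE /= => ?; exists n.
have [n _ pn] := close 0%N.
have [m nm pm] := close n.+1.
have := far n m nm; apply/negP; rewrite -ltNge.
rewrite -(subrKA p) (le_lt_trans (ler_normD _ _)) // distrC.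
by rewrite [r / 2](_ : _ = r / 4 + r / 4) ?ltrD //; field.
Qed.

(** * Charts and transition mappings *)

Section chart_facts.
Context (R : realType) (m : model) (M : metricType R).
Implicit Types c d : chart m M.

Lemma chart_map_nbhs c p : chart_dom c p ->
  nbhs (chart_map c p) (chart_map c @` chart_dom c).
Proof.
move=> cp; apply: open_nbhs_nbhs; split; last by exists p.
by have [] := chart_image_domain c.
Qed.

Lemma chart_inv_cvg c p : chart_dom c p ->
  chart_inv c x @[x --> chart_map c p] --> p.
Proof.
move=> cp; have := @chart_inv_continuous _ _ _ c.
rewrite continuous_open_subspace; last by have [] := chart_image_domain c.
have ap : chart_map c p \in chart_map c @` chart_dom c.
  by apply/mem_set; exists p.
by move=> /(_ _ ap); rewrite /continuous_at chart_mapK ?inE.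
Qed.

(** A closed neighbourhood inside the chart domain is cut out first: the chart
    is continuous only on its domain, where it maps compact sets to compact
    sets. *)
Lemma compact_chart_image_nbhs c p : locally_compact [set: M] ->
  chart_dom c p -> exists2 K, compact K & nbhs (chart_map c p) K.
Proof.
move=> lcM cp.
have [B pB [cB _]] := lcM p I.
have [V pV VU] := uniform_regular (open_nbhs_nbhs (conj (chart_dom_open c) cp)).
exists (chart_map c @` (B `&` closure V)).
  apply: continuous_compact.
    by apply: continuous_subspaceW (@chart_map_continuous _ _ _ c) => x [_ /VU].
  by apply: compact_closedI => //; exact: closed_closure.
have pVB : nbhs p (B `&` closure V).
  apply: filterI; last by apply: filterS pV; exact: subset_closure.
  by move: pB; rewrite /within /=; apply: filterS => q; exact.
have near_inv : \forall x \near chart_map c p, (B `&` closure V) (chart_inv c x).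
  exact: chart_inv_cvg cp _ pVB.
apply: filterS2 near_inv (chart_map_nbhs cp) => x /= VBx [q cq qx].
by exists (chart_inv c x); rewrite // -qx chart_mapK ?inE.
Qed.

Lemma transition_cancel_near c d p : chart_dom c p -> chart_dom d p ->
  \forall x \near chart_map d p, (transition d c \o transition c d) x = x.
Proof.
move=> cp dp.
have near_c : \forall x \near chart_map d p, chart_dom c (chart_inv d x).
  exact: chart_inv_cvg dp _ (open_nbhs_nbhs (conj (chart_dom_open c) cp)).
apply: filterS2 near_c (chart_map_nbhs dp) => x /= cx [q dq qx].
by rewrite /transition /= chart_mapK ?inE // -qx chart_mapK ?inE.
Qed.

Lemma transition_chart_map c d p : chart_dom d p ->
  transition c d (chart_map d p) = chart_map c p.
Proof. by move=> dp; rewrite /transition /= chart_mapK ?inE. Qed.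

Definition superlinearly_superdifferentiable c d :=
  right_superlinearly_superdifferentiable (transition_dom c d) (transition c d) \/
  left_superlinearly_superdifferentiable (transition_dom c d) (transition c d).

Lemma transition_superdifferential c d p : chart_dom c p -> chart_dom d p ->
  superlinearly_superdifferentiable c d ->
  differentiable (transition c d) (chart_map d p) /\
  ((forall h a, 'd (transition c d) (chart_map d p) (rmul h a) =
                rmul ('d (transition c d) (chart_map d p) h) a) \/
   (forall h a, 'd (transition c d) (chart_map d p) (lmul a h) =
                lmul a ('d (transition c d) (chart_map d p) h))).
Proof.
move=> cp dp; have Dp : transition_dom c d (chart_map d p) by exists p.
by case=> /(_ _ Dp)[dT lin]; split=> //; [left | right].
Qed.

Lemma transition_differential_inj c d p : chart_dom c p -> chart_dom d p ->
  differentiable (transition c d) (chart_map d p) ->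
  differentiable (transition d c) (chart_map c p) ->
  injective ('d (transition c d) (chart_map d p)).
Proof.
move=> cp dp dT dT'; apply: can_inj.
apply: diff_left_inverse dT _ (transition_cancel_near cp dp).
by rewrite transition_chart_map.
Qed.

End chart_facts.

(** * Orientability *)

Lemma transition_real_det_gt0 (R : realType) (m : model) (M : metricType R)
    (c d : chart m M) (p : M) :
  locally_compact [set: M] -> chart_dom c p -> chart_dom d p ->
  superlinearly_superdifferentiable c d ->
  superlinearly_superdifferentiable d c ->
  exists2 delta, real_det ('d (transition c d) (chart_map d p)) delta & 0 < delta.
Proof.
move=> lcM cp dp cd dc.
have [dT lin] := transition_superdifferential cp dp cd.
have [dT' _] := transition_superdifferential dp cp dc.
have injT := transition_differential_inj cp dp dT dT'.
case: m c d cp dp {cd dc} dT lin dT' injT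
  => [n|] c d cp dp dT lin dT' injT.
  exact: superlinear_real_det_gt0.
have [K cK nK] := compact_chart_image_nbhs lcM cp.
by case: (l2_nat_compact_not_nbhs cK nK).
Qed.

Theorem theorem2p1p3p7 (R : realType) (m : model) (M : metricType R)
    (Q : quaternion_manifold m M)
    (lcM : locally_compact [set: M])
    (superlin : forall j k : atlas_index Q,
      chart_dom (atlas j) `&` chart_dom (atlas k) !=set0 ->
      right_superlinearly_superdifferentiable
        (transition_dom (atlas j) (atlas k)) (transition (atlas j) (atlas k)) \/
      left_superlinearly_superdifferentiable
        (transition_dom (atlas j) (atlas k)) (transition (atlas j) (atlas k))) :
  orientable Q.
Proof.
exists (fun _ _ => true); split=> [j p _|j k p jp kp]; first exact: nearW.
have jk : chart_dom (atlas j) `&` chart_dom (atlas k) !=set0 by exists p.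
have kj : chart_dom (atlas k) `&` chart_dom (atlas j) !=set0 by exists p.
have [delta det_delta delta0] :=
  transition_real_det_gt0 lcM jp kp (superlin _ _ jk) (superlin _ _ kj).
by exists delta; rewrite delta0 gt_eqF.
Qed.
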